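(* Let $n,m\ge 1$, let $\mathbf{x}\in\mathbb{R}^n$, let $\mathbf{w}=(w_1,\ldots,w_m)\in\mathbb{R}^m$ with $w_i>0$ for all $i$, and let $G_1,\ldots,G_m\subseteq\{1,2,\ldots,n\}$ (which may overlap arbitrarily). For $j=1,\ldots,n$ let $k_j$ be the number of indices $i\in\{1,\ldots,m\}$ with $j\in G_i$, and let $\mathbf{U}=\operatorname{diag}(\sqrt{k_1}\|\mathbf{w}\|_2,\ldots,\sqrt{k_n}\|\mathbf{w}\|_2)$. Then $$\sum_{i=1}^{m}w_i\|\mathbf{x}_{G_i}\|_2\le \|\mathbf{U}\mathbf{x}\|_2,$$ and equality holds if and only if $$\frac{\|\mathbf{x}_{G_1}\|_2}{w_1}=\cdots=\frac{\|\mathbf{x}_{G_m}\|_2}{w_m}.$$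
   Context: For a subset $G\subseteq\{1,\ldots,n\}$ and $\mathbf{x}\in\mathbb{R}^n$, $\mathbf{x}_G\in\mathbb{R}^{|G|}$ denotes the subvector of $\mathbf{x}$ with entries $x_j$, $j\in G$, so $\|\mathbf{x}_G\|_2=\sqrt{\sum_{j\in G}x_j^2}$. $\|\cdot\|_2$ is the Euclidean norm. *)

(* Defs.v *)
From mathcomp Require Import all_boot all_order all_algebra.
From mathcomp Require Import reals.

Set Implicit Arguments.
Unset Strict Implicit.
Unset Printing Implicit Defensive.

Import Order.TTheory GRing.Theory Num.Theory.
Local Open Scope ring_scope.

(* The norm `|v| that MathComp-Analysis puts on matrices is the sup norm, so
   the Euclidean norm is defined here. *)
Definition norm2 (R : realType) (n : nat) (v : 'cV[R]_n) : R :=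
  Num.sqrt (\sum_(j < n) v j 0 ^+ 2).

(* The entries x_j, j \in G, in the order of enum G. *)
Definition subvec (R : realType) (n : nat) (G : {set 'I_n}) (x : 'cV[R]_n) :
    'cV[R]_#|G| :=
  rowsub (fun k : 'I_#|G| => enum_val k) x.

Definition group_count (n m : nat) (G : 'I_m -> {set 'I_n}) (j : 'I_n) : nat :=
  #|[set i : 'I_m | j \in G i]|.

Definition group_weight_mx (R : realType) (n m : nat) (w : 'cV[R]_m)
    (G : 'I_m -> {set 'I_n}) : 'M[R]_n :=
  diag_mx (\row_(j < n) (Num.sqrt (group_count G j)%:R * norm2 w)).

(* Main.v *)
Require Import Defs.
From mathcomp Require Import all_boot all_order all_algebra.
From mathcomp Require Import reals.
From mathcomp Require Import ring.

(** Write [a_i] for the norm of the subvector of [x] on [G_i].  Counting the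
    pairs [(i, j)] with [j] in [G_i] in both orders shows that
    [\sum_i a_i ^+ 2 = \sum_j k_j * x_j ^+ 2], so the squared right-hand side
    is exactly [(\sum_i w_i ^+ 2) * (\sum_i a_i ^+ 2)]: overlapping groups are
    paid for by the factors [k_j], with no loss
    ([norm2_group_weight_mxM_sqr]).  The claim is therefore the Cauchy-Schwarz
    inequality for [w] and [a].

    Lagrange's identity ([lagrange_identity]) writes the Cauchy-Schwarz defect
    as a sum of the squares [(w_i * a_j - w_j * a_i) ^+ 2].  This gives the
    inequality, and equality exactly when all these squares vanish, which for
    positive weights says that the ratios [a_i / w_i] agree. *)

Import Order.TTheory GRing.Theory Num.Theory.
Local Open Scope ring_scope.

(** Summing over all ordered pairs counts each unordered pair twice, whence
    the factors 2; this form avoids an order on [I] and division by 2. *)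
Lemma lagrange_identity (R : comPzRingType) (I : finType) (u v : I -> R) :
  ((\sum_i u i ^+ 2) * (\sum_i v i ^+ 2)) *+ 2 =
    (\sum_i u i * v i) ^+ 2 *+ 2
    + \sum_i \sum_j (u i * v j - u j * v i) ^+ 2.
Proof.
have -> : \sum_i \sum_j (u i * v j - u j * v i) ^+ 2 =
    \sum_i \sum_j u i ^+ 2 * v j ^+ 2 + \sum_i \sum_j v i ^+ 2 * u j ^+ 2
    - (\sum_i \sum_j (u i * v i) * (u j * v j)) *+ 2.
  rewrite mulr2n opprD -!sumrN -!big_split; apply: eq_bigr => i _ /=.
  rewrite -!sumrN -!big_split; apply: eq_bigr => j _ /=.
  by ring.
by rewrite -!big_distrlr /=; ring.
Qed.

(** The defect in Lagrange's identity is nonnegative, and it vanishes exactly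
    when every one of its squares does. *)
Lemma cauchy_schwarz_leif (R : realDomainType) (I : finType) (u v : I -> R) :
  (\sum_i u i * v i) ^+ 2 <= (\sum_i u i ^+ 2) * (\sum_i v i ^+ 2)
    ?= iff [forall i, forall j, u i * v j == u j * v i].
Proof.
have defect_ge0 i : 0 <= \sum_j (u i * v j - u j * v i) ^+ 2.
  by apply: sumr_ge0 => j _; apply: sqr_ge0.
split.
  rewrite -(@ler_pMn2r R 2) // lagrange_identity lerDl.
  by apply: sumr_ge0 => i _.
rewrite -(@eqr_pMn2r R 2) // lagrange_identity eq_sym -subr_eq0 addrAC subrr.
rewrite add0r psumr_eq0 //.
apply/allP/forallP => [h i|h i _]; last first.
  rewrite psumr_eq0 => [|j _]; last exact: sqr_ge0.
  by apply/allP => j _; rewrite sqrf_eq0 subr_eq0; apply: (forallP (h i)).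
apply/forallP => j; have := h i (mem_index_enum i).
rewrite psumr_eq0 => [/allP/(_ j (mem_index_enum j))|k _].
  by rewrite sqrf_eq0 subr_eq0.
exact: sqr_ge0.
Qed.

Lemma norm2_ge0 (R : realType) (n : nat) (v : 'cV[R]_n) : 0 <= norm2 v.
Proof. exact: sqrtr_ge0. Qed.

Lemma norm2_sqr (R : realType) (n : nat) (v : 'cV[R]_n) :
  norm2 v ^+ 2 = \sum_(j < n) v j 0 ^+ 2.
Proof. by rewrite sqr_sqrtr //; apply: sumr_ge0 => j _; apply: sqr_ge0. Qed.

Lemma norm2_subvec_sqr (R : realType) (n : nat) (A : {set 'I_n})
    (x : 'cV[R]_n) :
  norm2 (subvec A x) ^+ 2 = \sum_(j in A) x j 0 ^+ 2.
Proof.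
by rewrite norm2_sqr [RHS]big_enum_val; apply: eq_bigr => k _; rewrite mxE.
Qed.

(** Double counting of the incidences between coordinates and groups. *)
Lemma sum_norm2_subvec_sqr (R : realType) (n m : nat) (x : 'cV[R]_n)
    (G : 'I_m -> {set 'I_n}) :
  \sum_(i < m) norm2 (subvec (G i) x) ^+ 2
  = \sum_(j < n) (group_count G j)%:R * x j 0 ^+ 2.
Proof.
under eq_bigr do rewrite norm2_subvec_sqr.
rewrite (exchange_big_dep predT) //=; apply: eq_bigr => j _.
rewrite sumr_const mulr_natl /group_count; congr (_ *+ _).
by apply: eq_card => i; rewrite !inE.
Qed.

Lemma norm2_group_weight_mxM_sqr (R : realType) (n m : nat) (x : 'cV[R]_n)
    (w : 'cV[R]_m) (G : 'I_m -> {set 'I_n}) :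
  norm2 (group_weight_mx w G *m x) ^+ 2
  = (\sum_(i < m) w i 0 ^+ 2) * (\sum_(i < m) norm2 (subvec (G i) x) ^+ 2).
Proof.
rewrite sum_norm2_subvec_sqr -norm2_sqr norm2_sqr mulr_sumr.
apply: eq_bigr => j _; rewrite mul_diag_mx !mxE !exprMn sqr_sqrtr ?ler0n //.
by rewrite [RHS]mulrCA mulrA.
Qed.

Theorem lemma1p3 (R : realType) (n m : nat) (hn : (1 <= n)%N) (hm : (1 <= m)%N)
    (x : 'cV[R]_n) (w : 'cV[R]_m) (hw : forall i : 'I_m, 0 < w i 0)
    (G : 'I_m -> {set 'I_n}) :
  let U : 'M[R]_n := group_weight_mx w G in
  \sum_(i < m) w i 0 * norm2 (subvec (G i) x) <= norm2 (U *m x)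
  /\ (\sum_(i < m) w i 0 * norm2 (subvec (G i) x) = norm2 (U *m x)
      <-> forall i j : 'I_m,
            norm2 (subvec (G i) x) / w i 0 = norm2 (subvec (G j) x) / w j 0).
Proof.
move=> U.
have S_ge0 : 0 <= \sum_(i < m) w i 0 * norm2 (subvec (G i) x).
  by apply: sumr_ge0 => i _; rewrite mulr_ge0 ?norm2_ge0 // ltW.
have [le_sqr eq_sqr] :=
  cauchy_schwarz_leif _ _ (fun i => w i 0) (fun i => norm2 (subvec (G i) x)).
rewrite -norm2_group_weight_mxM_sqr in le_sqr eq_sqr.
rewrite ler_pXn2r ?nnegrE ?norm2_ge0 // in le_sqr.
rewrite eqrXn2 ?norm2_ge0 // in eq_sqr.
have w_neq0 i : w i 0 != 0 by rewrite gt_eqF.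
split=> //; split=> [/eqP | eq_ratio].
  rewrite eq_sqr => /forallP eq_cross i j; apply/eqP.
  by rewrite eqr_div // mulrC [eqbRHS]mulrC eq_sym; apply: (forallP (eq_cross i)).
apply/eqP; rewrite eq_sqr; apply/forallP => i; apply/forallP => j.
by rewrite eq_sym mulrC [eqbRHS]mulrC -eqr_div //; apply/eqP.
Qed.
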